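(* A stable noncommutative polynomial $P\in\mathbb{C}\langle A\rangle$ satisfies, for every $n\ge2$ and every $1\le i<n$, \[ P_n(a_1,\dots,a_n)\big|_{a_{i+1}=a_i}=P_{n-2}(a_1,\dots,a_{i-1},a_{i+2},\dots,a_n) \] if and only if $P$ belongs to $\mathbf{WQSym}(\mathbb{A})=\{F(\mathbb{A}):F\in\mathbf{WQSym}\}$.
   Context: $A=\{a_1,a_2,\dots\}$ noncommuting variables; a stable noncommutative polynomial is $P=(P_n)_{n\ge0}$, $P_n\in\mathbb{C}\langle a_1,\dots,a_n\rangle$, of bounded degree, with $P_{n+1}(a_1,\dots,a_n,0)=P_n$; they form $\mathbb{C}\langle A\rangle$. For a word $w$ over $\mathbb{Z}_{>0}$, $\mathbf{a}_w=a_{w_1}\cdots a_{w_k}$. A word $u$ is packed if whenever letter $j+1$ occurs, $j$ occurs; $\mathrm{pack}(w)$ replaces the smallest letter of $w$ by $1$, the second smallest by $2$, etc. $\mathbf{WQSym}$ is the span of $P_u=\sum_{\mathrm{pack}(w)=u}\mathbf{a}_w$ over packed words $u$. The evaluation on the virtual alphabet $\mathbb{A}=\ominus(a_1)\oplus(a_2)\ominus(a_3)\cdots$ is the linear map $F\mapsto F(\mathbb{A})$ given, for a packed word $u=u_1\cdots u_n$ with largest letter $r$, by: $P_u(\mathbb{A})$ is the stable noncommutative polynomial whose $N$-th component is \[ \sum_g\ \prod_{j\ \mathrm{odd}}(-1)^{|g^{-1}(j)|}\ a_{g(u_1)}a_{g(u_2)}\cdots a_{g(u_n)}, \] the sum over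 weakly increasing maps $g:\{1,\dots,r\}\to\{1,\dots,N\}$ with $|g^{-1}(j)|\le1$ for every even $j$. *)

(* Defs.v *)
From HB Require Import structures.
From mathcomp Require Import all_boot all_order all_algebra.
From mathcomp Require Import finmap.
From mathcomp Require Import boolp classical_sets reals.
From mathcomp Require Import complex.
From mathcomp Require Import monalg.

Set Implicit Arguments.
Unset Strict Implicit.
Unset Printing Implicit Defensive.

Import GRing.Theory.

Local Open Scope ring_scope.

(* C<a_1, ..., a_n>, where C is R[i] and i : 'I_n stands for a_(i+1). *)
Notation ncpoly R n := {malg (complex R)[{fmonom 'I_n}]}.

(* Families (P_n)_n with P_n in C<a_1, ..., a_n>. *)
Notation ncfamily R := (forall n : nat, ncpoly R n).

Section NoncommutativePolynomials.
Variable R : realType.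

Definition ncmonom n (w : seq 'I_n) : ncpoly R n := << FMonom w >>.

Definition ncvar n (i : 'I_n) : ncpoly R n := ncmonom [:: i].

(* The morphism of C-algebras sending the variable i to s i. *)
Definition ncsubst m n (s : 'I_m -> ncpoly R n) (p : ncpoly R m) : ncpoly R n :=
  mmap malgC (fun w : {fmonom 'I_m} => \prod_(i <- (w : seq 'I_m)) s i) p.

Definition last_zero n (i : 'I_n.+1) : ncpoly R n :=
  if unlift ord_max i is Some j then ncvar j else 0.

Definition bounded_degree (P : ncfamily R) : Prop :=
  exists d : nat, forall n (w : {fmonom 'I_n}), w \in msupp (P n) ->
    (fdeg w <= d)%N.

Definition stable (P : ncfamily R) : Prop :=
  bounded_degree P /\ forall n, ncsubst (@last_zero n) (P n.+1) = P n.

(* For i : 'I_n.+1, the two adjacent variables of C<a_1, ..., a_(n+2)> singled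
   out by i are a_(i+1) and a_(i+2), i.e. the ordinals i and i+1 of 'I_n.+2. *)
Definition merge_next n (i : 'I_n.+1) (j : 'I_n.+2) : ncpoly R n.+2 :=
  ncvar (if j == i.+1 :> nat then inord i else j).

Definition skip_two n (i : 'I_n.+1) (j : 'I_n) : ncpoly R n.+2 :=
  ncvar (inord (if (j < i)%N then j : nat else j.+2)).

End NoncommutativePolynomials.

(* In words over the positive integers, the letter k stands for a_k. *)
Definition pack (w : seq nat) : seq nat :=
  [seq (index x (sort leq (undup w))).+1 | x <- w].

Definition packed (u : seq nat) : bool :=
  (0%N \notin u) && all (fun j => (1 < j)%N ==> (j.-1 \in u)) u.

Definition packed_word : Type := {u : seq nat | packed u}.

Definition letters n (w : seq 'I_n) : seq nat := [seq i.+1 | i : 'I_n <- w].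

Definition max_letter (u : seq nat) : nat := (\max_(x <- u) x)%N.

Lemma packed_leq (u : seq nat) j k :
  packed u -> k \in u -> (0 < j <= k)%N -> j \in u.
Proof.
case/andP=> u0 /allP pu; elim: k => [|k IHk] ku /andP[j0 jk].
  by rewrite leqNgt j0 in jk.
move: jk; rewrite leq_eqVlt ltnS => /orP[/eqP -> //|jk].
apply: IHk; last by rewrite j0.
by have := pu _ ku; rewrite ltnS (leq_trans j0 jk).
Qed.

Lemma leq_max_letter (u : seq nat) k : k \in u -> (k <= max_letter u)%N.
Proof. by move=> ku; rewrite /max_letter (big_rem k) //= leq_max leqnn. Qed.

Lemma max_letter_in (u : seq nat) : (0 < max_letter u)%N -> max_letter u \in u.
Proof.
elim: u => [|x u IHu]; rewrite /max_letter ?big_nil // big_cons.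
rewrite -/(max_letter u) inE => h.
have [le|lt] := leqP (max_letter u) x.
  by rewrite eqxx.
by rewrite IHu ?orbT // (leq_ltn_trans _ lt).
Qed.

Lemma mem_packed (u : seq nat) k :
  packed u -> (k \in u) = (0 < k <= max_letter u)%N.
Proof.
move=> pu; apply/idP/idP => [ku|/andP[k0 kr]].
  rewrite leq_max_letter // andbT lt0n; apply/eqP => k0.
  by case/andP: pu; rewrite -k0 ku.
apply: (packed_leq pu (max_letter_in (leq_trans k0 kr))).
by rewrite k0.
Qed.

Lemma pack_packed (u : seq nat) : packed u -> pack u = u.
Proof.
move=> pu; rewrite /pack.
have -> : sort leq (undup u) = iota 1 (max_letter u).
  apply: (irr_sorted_eq ltn_trans ltnn); last first.
  - by move=> k; rewrite mem_sort mem_undup mem_packed // mem_iota add1n ltnS.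
  - exact: iota_ltn_sorted.
  - by rewrite ltn_sorted_uniq_leq sort_uniq undup_uniq sort_sorted //;
      exact: leq_total.
rewrite -[RHS]map_id; apply/eq_in_map => k.
rewrite mem_packed // => /andP[k0 kr].
have {1}-> : k = nth 0%N (iota 1 (max_letter u)) k.-1.
  by rewrite nth_iota ?add1n ?prednK.
rewrite index_uniq ?iota_uniq ?size_iota //; first exact: prednK.
by rewrite prednK.
Qed.

Lemma max_letter_size (u : seq nat) : packed u -> (max_letter u <= size u)%N.
Proof.
move=> pu; rewrite -(size_iota 1 (max_letter u)).
apply: uniq_leq_size (iota_uniq _ _) _ => k.
by rewrite mem_iota add1n ltnS mem_packed.
Qed.

Lemma packed_letters (u : seq nat) n : packed u -> (max_letter u <= n)%N ->
  exists w : seq 'I_n, letters w = u.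
Proof.
move=> pu un; exists (pmap insub [seq l.-1 | l <- u]).
rewrite /letters.
have : all (fun k => 0 < k <= n)%N u.
  apply/allP=> k; rewrite mem_packed // => /andP[-> kr] /=.
  exact: leq_trans un.
elim: u {pu un} => //= k u IHu /andP[/andP[k0 kn] /IHu e].
by rewrite insubT ?prednK //= => ?; rewrite prednK // e.
Qed.

Section WQSym.
Variable R : realType.

(* pack preserves the length, so only words of length size u contribute. *)
Definition Pbasis (u : packed_word) : ncfamily R := fun n =>
  \sum_(w : (size (val u)).-tuple 'I_n | pack (letters w) == val u) ncmonom R w.

Definition Pcomb (c : {malg (complex R)[packed_word]}) : ncfamily R := fun n =>
  \sum_(u <- msupp c) c@_u *: Pbasis u n.

Definition WQSym (F : ncfamily R) : Prop :=
  exists c : {malg (complex R)[packed_word]}, F = Pcomb c.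

(* Letters of u lie in {1, ..., r}: the letter l is the ordinal l.-1 of 'I_r,
   and no letter is dropped when r is the largest letter of u. *)
Definition relabel r N (g : 'I_r -> 'I_N) (u : seq nat) : seq 'I_N :=
  [seq g x | x <- pmap insub [seq l.-1 | l <- u]].

(* Parity refers to the index j.+1 of the variable a_(j+1). *)
Definition admissible r N (g : {ffun 'I_r -> 'I_N}) : bool :=
  [forall x : 'I_r, forall y : 'I_r, (x <= y)%N ==> (g x <= g y)%N]
  && [forall j : 'I_N, ~~ odd j.+1 ==> (#|[set x | g x == j]| <= 1)%N].

Definition Pvirtual (u : packed_word) : ncfamily R := fun N =>
  \sum_(g : {ffun 'I_(max_letter (val u)) -> 'I_N} | admissible g)
    (\prod_(j : 'I_N | odd j.+1) (-1) ^+ #|[set x | g x == j]|)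
      *: ncmonom R (relabel g (val u)).

(* The coordinates of F in the basis P_u, and 0 when F is not in WQSym. *)
Definition Pcoord (F : ncfamily R) : {malg (complex R)[packed_word]} :=
  xget 0 [set c | F = Pcomb c].

(* F(A) on the virtual alphabet A = -(a_1) + (a_2) - (a_3) + ... *)
Definition evalA (F : ncfamily R) : ncfamily R := fun N =>
  \sum_(u <- msupp (Pcoord F)) (Pcoord F)@_u *: Pvirtual u N.

Lemma mcoeff_ncmonom n (w : seq 'I_n) (v : {fmonom 'I_n}) :
  (ncmonom R w)@_v = (w == v)%:R.
Proof. by rewrite /ncmonom mcoeffU -val_eqE. Qed.

Lemma mcoeff_Pbasis u n (w : seq 'I_n) :
  (Pbasis u n)@_(FMonom w) = (pack (letters w) == val u)%:R.
Proof.
rewrite /Pbasis raddf_sum /=.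
under eq_bigr do rewrite mcoeff_ncmonom /=.
have [e|ne] := eqVneq (pack (letters w)) (val u); last first.
  rewrite big1 // => v /eqP ev; case: eqP => // vw.
  by rewrite -vw ev eqxx in ne.
have sw : size w == size (val u) by rewrite -e !size_map.
rewrite (bigD1 (Tuple sw)) /=; last by rewrite e.
rewrite eqxx big1 ?addr0 // => v /andP[_].
by rewrite -val_eqE /= => /negPf ->.
Qed.

Lemma mcoeff_Pcomb c (u : packed_word) n (w : seq 'I_n) :
  letters w = val u -> (Pcomb c n)@_(FMonom w) = c@_u.
Proof.
move=> wu; rewrite /Pcomb raddf_sum /=.
under eq_bigr => v _ do
  rewrite mcoeffZ mcoeff_Pbasis wu (pack_packed (valP u)) val_eqE.
have [uc|uc] := boolP (u \in msupp c).
  rewrite (big_fsetD1 u) //= eqxx mulr1 big1_fset ?addr0 // => v.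
  by rewrite in_fsetD1 eq_sym => /andP[/negPf -> _] _; rewrite mulr0.
rewrite (mcoeff_outdom uc) big1_fset // => v vc _.
by case: eqP => [uv|]; rewrite ?mulr0 // -uv (negPf uc) in vc *.
Qed.

Lemma Pcomb_inj : injective Pcomb.
Proof.
move=> c d cd; apply/malgP => u.
have [w wu] := packed_letters (valP u) (max_letter_size (valP u)).
by rewrite -(mcoeff_Pcomb c wu) cd (mcoeff_Pcomb d wu).
Qed.

Lemma PcombK c : Pcoord (Pcomb c) = c.
Proof.
rewrite /Pcoord; case: xgetP => [d _ /= /Pcomb_inj //|].
by move=> /(_ c) /= [].
Qed.

Lemma msupp_sum_linear (V : lmodType (complex R)) (f : packed_word -> V) :
  linear (fun c : {malg (complex R)[packed_word]} =>
            \sum_(u <- msupp c) c@_u *: f u).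
Proof.
move=> a c d /=.
have widen (D : {fset packed_word}) e : (msupp e `<=` D)%fset ->
    \sum_(u <- msupp e) e@_u *: f u = \sum_(u <- D) e@_u *: f u.
  move=> sD; apply: big_fset_incl => // u _ /mcoeff_outdom ->.
  by rewrite scale0r.
set D := (msupp c `|` msupp d `|` msupp (a *: c + d))%fset.
have sm : (msupp (a *: c + d) `<=` D)%fset by rewrite /D fsubsetUr.
have sc : (msupp c `<=` D)%fset by rewrite /D -fsetUA fsubsetUl.
have sd : (msupp d `<=` D)%fset by rewrite /D fsetUAC fsubsetUr.
rewrite (widen _ _ sm) (widen _ _ sc) (widen _ _ sd).
rewrite scaler_sumr -big_split; apply: eq_bigr => u _ /=.
by rewrite mcoeffD mcoeffZ scalerDl scalerA.
Qed.

Lemma Pcomb_Pbasis u : Pcomb << u >> = Pbasis u.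
Proof.
apply: functional_extensionality_dep => n; rewrite /Pcomb msuppU oner_eq0.
by rewrite big_seq_fset1 mcoeffUU scale1r.
Qed.

Lemma evalA_Pbasis u : evalA (Pbasis u) = Pvirtual u.
Proof.
apply: functional_extensionality_dep => n.
rewrite /evalA -Pcomb_Pbasis PcombK msuppU oner_eq0.
by rewrite big_seq_fset1 mcoeffUU scale1r.
Qed.

Lemma evalA_linear a F G : WQSym F -> WQSym G ->
  evalA (fun n => a *: F n + G n) = (fun n => a *: evalA F n + evalA G n).
Proof.
move=> [c ->] [d ->]; apply: functional_extensionality_dep => n.
have -> : (fun n => a *: Pcomb c n + Pcomb d n) = Pcomb (a *: c + d).
  apply: functional_extensionality_dep => m.
  by rewrite -(msupp_sum_linear (fun u => Pbasis u m)).
by rewrite /evalA !PcombK (msupp_sum_linear (fun u => Pvirtual u n)).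
Qed.

End WQSym.

(* Main.v *)
(* A word has a coefficient in P that does not depend on n, and the functional
   equation says two things about these coefficients q.  If the letters i, i+1
   do not occur in w, then q is unchanged when all letters above i+1 are lowered
   by 2.  If i occurs in w at the positions S and i+1 does not occur, then the
   sum over T in S of q (w with i+1 at the positions of T) is zero.

   The values P_u(A) satisfy the functional equation: after a_(i+1) = a_i, the
   terms whose map g takes the value i or i+1 cancel in pairs, by moving one
   letter of u between i and i+1.

   Conversely, q is determined by its values on the words 2u, u packed: for an
   odd letter i of w, first raise the letters above i by 2 and then use the
   second relation, which expresses q w by words with fewer odd letters; when
   all letters are even, the first relation closes the gaps.  Since the
   coefficient of 2u in P_v(A) is 1 if u = v and 0 otherwise, P is the sum of
   the q (2u) P_u(A), a finite sum because P has bounded degree. *)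

From HB Require Import structures.
Require Import Defs.
From mathcomp Require Import all_boot all_order all_algebra.
From mathcomp Require Import finmap.
From mathcomp Require Import boolp classical_sets reals.
From mathcomp Require Import complex.
From mathcomp Require Import monalg.
From mathcomp Require Import zify.

Set Implicit Arguments.
Unset Strict Implicit.
Unset Printing Implicit Defensive.

Import GRing.Theory.

Local Open Scope ring_scope.

(** * Coefficients after substitution *)

Section Substitution.
Variables (R : realType) (m n : nat) (s : 'I_m -> ncpoly R n).

Lemma ncsubst_is_linear : linear (ncsubst s).
Proof.
move=> a p q; rewrite /ncsubst mmapD; congr (_ + _).
rewrite (mmapEw (msuppZ_le _ _)) mmapE scaler_sumr; apply: eq_bigr => w _.
by rewrite mcoeffZ !mul_malgC scalerA.
Qed.

HB.instance Definition _ :=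
  GRing.isLinear.Build (complex R) (ncpoly R m) (ncpoly R n) _ (ncsubst s)
    ncsubst_is_linear.

Lemma ncmonom_cons k (i : 'I_k) w :
  ncmonom R (i :: w) = ncvar R i * ncmonom R w.
Proof.
rewrite /ncvar /ncmonom malgM_def fgmulUU mulr1; congr << _ >>.
by apply/val_inj; rewrite /= fmM.
Qed.

Lemma ncmonom_nil k : ncmonom R ([::] : seq 'I_k) = 1.
Proof.
by rewrite /ncmonom; congr << _ >>; apply/val_inj; rewrite /= fm1.
Qed.

Lemma ncsubst_ncmonom w : ncsubst s (ncmonom R w) = \prod_(i <- w) s i.
Proof. by rewrite /ncsubst mmapU mul_malgC scale1r. Qed.

Lemma prod_ncvar (f : 'I_m -> 'I_n) w :
  \prod_(i <- w) ncvar R (f i) = ncmonom R (map f w).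
Proof.
elim: w => [|i w IHw]; first by rewrite big_nil ncmonom_nil.
by rewrite big_cons IHw ncmonom_cons.
Qed.

(** Each variable goes to a variable or, for [None], to 0, so a monomial goes to a monomial or to 0.
    This form covers [last_zero], [merge_next] and [skip_two] alike. *)
Lemma mcoeff_ncsubst (f : 'I_m -> option 'I_n) p v :
    (forall i, s i = oapp (@ncvar R n) 0 (f i)) ->
  (ncsubst s p)@_(FMonom v) =
    \sum_(w <- msupp p | map f w == map Some v) p@_w.
Proof.
move=> sE; rewrite /ncsubst mmapE raddf_sum /= [RHS]big_mkcond.
apply: eq_bigr => -[w] _ /=; rewrite mcoeffCM.
rewrite -[RHS]mulrb -[RHS]mulr_natr.
congr (_ * _); rewrite (eq_bigr (fun i => oapp (@ncvar R n) 0 (f i))) //.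
have -> : \prod_(i <- w) oapp (@ncvar R n) 0 (f i) =
    if all (fun i => f i) w then ncmonom R (pmap f w) else 0.
  elim: w => [|i w IHw]; first by rewrite big_nil ncmonom_nil.
  rewrite big_cons IHw /=; case: (f i) => [j|] /=; last by rewrite mul0r.
  by case: ifP => _; rewrite ?mulr0 // ncmonom_cons.
case: allP => [fw|fw]; last first.
  rewrite mcoeff0; case: eqP => // e; case: fw => i iw.
  by have := map_f f iw; rewrite e => /mapP[j _ ->].
rewrite mcoeff_ncmonom /= -(inj_eq (inj_map (@Some_inj _))).
rewrite [X in (X == _)%:R](_ : _ = map f w) //.
elim: w fw => //= i w IHw fw; have := fw i (mem_head _ _).
case: (f i) => //= j _; rewrite IHw // => k kw.
by apply: fw; rewrite inE kw orbT.
Qed.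

End Substitution.

(** The case in which at most one word of the fibre over [v] contributes. *)
Lemma mcoeff_ncsubst1 (R : realType) m n (s : 'I_m -> ncpoly R n)
    (f : 'I_m -> option 'I_n) p v w0 :
    (forall i, s i = oapp (@ncvar R n) 0 (f i)) ->
    map f w0 = map Some v ->
    (forall w, map f w = map Some v -> w != w0 -> p@_(FMonom w) = 0) ->
  (ncsubst s p)@_(FMonom v) = p@_(FMonom w0).
Proof.
move=> sE fw0 uniq_w0; rewrite (mcoeff_ncsubst _ _ sE).
case: (msuppP p (FMonom w0)) => w0p; last first.
  rewrite big_seq_cond big1 // => -[w] /andP[wp /eqP /uniq_w0]; apply.
  by apply: contraNneq w0p => <-.
rewrite big_mkcond (big_fsetD1 _ w0p) /= fw0 eqxx big_seq big1 ?addr0 //.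
move=> -[w]; rewrite in_fsetD1 => /andP[ww0 _] /=.
by case: eqP => // /uniq_w0; apply.
Qed.

(** * The functional equation on the virtual alphabet *)

(* Indices are 0-based: odd a means that the variable a accepts at most one
   letter, so admissible maps are those with g x, g y related for all x < y. *)
Definition precedes (a b : nat) := (a < b)%N || (a == b) && ~~ odd a.

Lemma admissibleE r N (g : {ffun 'I_r -> 'I_N}) :
  admissible g =
  [forall x : 'I_r, forall y : 'I_r, (x < y)%N ==> precedes (g x) (g y)].
Proof.
rewrite /admissible; apply/andP/forallP => [[/forallP mon /forallP inj] x|pre].
  apply/forallP => y; apply/implyP => xy; rewrite /precedes.
  have := mon x => /forallP/(_ y); rewrite (ltnW xy) /= leq_eqVlt.
  case: eqP => /= [e _|_ -> //]; apply/orP; right; apply/negP => odd_gx.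
  have := inj (g x); rewrite /= odd_gx /= => /card_le1_eqP/(_ y x).
  by rewrite !inE (val_inj e) eqxx => /(_ isT isT) yx; rewrite yx ltnn in xy.
split; apply/forallP => x.
  apply/forallP => y; apply/implyP; rewrite leq_eqVlt => /orP[/eqP/val_inj -> //|xy].
  have := pre x => /forallP/(_ y); rewrite xy /= /precedes.
  by case/orP => [/ltnW //|/andP[/eqP -> _]].
apply/implyP => /= odd_x; rewrite negbK in odd_x.
apply/card_le1_eqP => y z; rewrite !inE => /eqP gy /eqP gz.
apply/eqP; rewrite -val_eqE /=.
have gyz : g y = g z by rewrite gy gz.
case: ltngtP => // lt;
  [have := pre z => /forallP/(_ y)|have := pre y => /forallP/(_ z)];
  by rewrite lt /= /precedes gyz ltnn eqxx gz odd_x.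
Qed.

Section Sign.
Variable R : realType.

(** The sign as a product over letters instead of variables: changing [g] at one letter changes one
    factor. *)
Definition vsign r N (g : {ffun 'I_r -> 'I_N}) : complex R :=
  \prod_x (if odd (g x) then 1 else -1).

Lemma vsignE r N (g : {ffun 'I_r -> 'I_N}) :
  \prod_(j : 'I_N | odd j.+1) (-1) ^+ #|[set x | g x == j]| = vsign g.
Proof.
rewrite /vsign (partition_big g predT) //= [LHS]big_mkcond.
apply: eq_bigr => j _; rewrite -prodr_const.
rewrite [RHS](eq_bigr (fun=> if odd j then 1 else -1)) => [|x /eqP -> //].
rewrite (eq_bigl (fun x => g x == j)) => [|x]; last by rewrite inE.
by case: (odd j); rewrite //= big1.
Qed.

End Sign.

(** * Cancellation in an adjacent pair of variables *)

Section AdjacentPair.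
Variables (r n : nat) (i : 'I_n.+1).

(** [merge_next] and [skip_two] are [ncvar] after this map and [skip_letter], so the cancellation
    can be proved on the maps [g] alone. *)
Definition merge_letter (j : 'I_n.+2) : 'I_n.+2 :=
  if j == i.+1 :> nat then inord i else j.

Definition skip_letter (j : 'I_n) : 'I_n.+2 :=
  inord (if (j < i)%N then j : nat else j.+2).

Definition in_pair (a : nat) := (a == i) || (a == i.+1).

Definition swap_letter (j : 'I_n.+2) : 'I_n.+2 :=
  if j == i.+1 :> nat then inord i else if j == i :> nat then inord i.+1 else j.

Lemma val_merge_letter j :
  merge_letter j = (if j == i.+1 :> nat then i : nat else j) :> nat.
Proof.
have := ltn_ord i; rewrite /merge_letter; case: ifP => // _ ?.
by rewrite inordK //; lia.
Qed.

Lemma val_skip_letter j :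
  skip_letter j = (if (j < i)%N then j : nat else j.+2) :> nat.
Proof.
have := ltn_ord j; rewrite /skip_letter => ?.
by rewrite inordK //; case: ifP; lia.
Qed.

Lemma val_swap_letter j : swap_letter j =
  (if j == i.+1 :> nat then i : nat else if j == i :> nat then i.+1 else j) :> nat.
Proof.
have := ltn_ord i; rewrite /swap_letter => ?.
case: ifP => _; first by rewrite inordK //; lia.
by case: ifP => // _; rewrite inordK //; lia.
Qed.

Lemma skip_letter_inj : injective skip_letter.
Proof.
move=> j k /(congr1 val); rewrite /= !val_skip_letter => e; apply/val_inj => /=.
by move: e; case: (ltnP j i); case: (ltnP k i); lia.
Qed.

Lemma skip_letter_ex (j : 'I_n.+2) : ~~ in_pair j -> exists k, j = skip_letter k.
Proof.
rewrite /in_pair => ij; have i_lt := ltn_ord i; have j_lt := ltn_ord j.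
have k_lt : ((if (j < i)%N then j : nat else (j - 2)%N) < n)%N.
  by case: (ltnP j i); lia.
exists (Ordinal k_lt); apply/val_inj; rewrite /= val_skip_letter /=.
case: (ltnP j i) => [-> //|ji].
by case: (ltnP (j - 2) i); lia.
Qed.

Lemma skip_letterN_pair j : ~~ in_pair (skip_letter j).
Proof. by rewrite val_skip_letter /in_pair; case: (ltnP j i); lia. Qed.

Lemma odd_skip_letter j : odd (skip_letter j) = odd j.
Proof. by rewrite val_skip_letter; case: ifP => //= _; rewrite negbK. Qed.

Lemma precedes_skip_letter j k :
  precedes (skip_letter j) (skip_letter k) = precedes j k.
Proof.
rewrite /precedes odd_skip_letter !val_skip_letter.
by case: (ltnP j i); case: (ltnP k i); lia.
Qed.

Lemma swap_letterK : involutive swap_letter.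
Proof.
move=> j; apply/val_inj; rewrite /= !val_swap_letter.
have [-> | ji1] := eqVneq (nat_of_ord j) i.+1.
  by rewrite ltn_eqF // eqxx.
have [-> | ji] := eqVneq (nat_of_ord j) i; first by rewrite eqxx.
by rewrite (negPf ji1) (negPf ji).
Qed.

Lemma in_pair_swap_letter j : in_pair (swap_letter j) = in_pair j.
Proof.
rewrite /in_pair val_swap_letter.
have [-> | ji1] := eqVneq (nat_of_ord j) i.+1; first by rewrite eqxx orbT.
have [_ | ji] := eqVneq (nat_of_ord j) i; first by rewrite eqxx orbT.
by rewrite /= (negPf ji1) (negPf ji).
Qed.

Lemma merge_swap_letter j : merge_letter (swap_letter j) = merge_letter j.
Proof.
apply/val_inj; rewrite /= !val_merge_letter val_swap_letter.
have [_ | ji1] := eqVneq (nat_of_ord j) i.+1; first by rewrite ltn_eqF.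
have [-> | ji] := eqVneq (nat_of_ord j) i; first by rewrite eqxx.
by rewrite (negPf ji1).
Qed.

Lemma odd_swap_letter (j : 'I_n.+2) : in_pair j -> odd (swap_letter j) = ~~ odd j.
Proof.
rewrite /in_pair val_swap_letter.
have [-> | _] := eqVneq (nat_of_ord j) i.+1; first by rewrite /= negbK.
rewrite orbF.
by have [-> | _] := eqVneq (nat_of_ord j) i.
Qed.

(* The pivot of g is the extreme letter sent to {i, i+1}, on the side of the
   variable of the pair that accepts at most one letter: swapping the value
   of g at its pivot keeps g admissible and changes its sign. *)
Definition pivot (g : {ffun 'I_r -> 'I_n.+2}) (p : 'I_r) :=
  in_pair (g p) &&
  [forall y : 'I_r, (if odd i then (y < p)%N else (p < y)%N) ==> ~~ in_pair (g y)].

Definition swap_at (p : 'I_r) (g : {ffun 'I_r -> 'I_n.+2}) :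
    {ffun 'I_r -> 'I_n.+2} :=
  [ffun x => if x == p then swap_letter (g x) else g x].

Lemma swap_atK p : involutive (swap_at p).
Proof.
move=> g; apply/ffunP => x; rewrite !ffunE.
by case: eqP => // _; rewrite swap_letterK.
Qed.

Lemma in_pair_swap_at p g x : in_pair (swap_at p g x) = in_pair (g x).
Proof. by rewrite ffunE; case: ifP => // _; rewrite in_pair_swap_letter. Qed.

Lemma pivot_swap_at p g : pivot (swap_at p g) =1 pivot g.
Proof.
move=> x; rewrite /pivot in_pair_swap_at; congr (_ && _).
by apply: eq_forallb => y; rewrite in_pair_swap_at.
Qed.

(** By monotonicity, only the pivot can take the value of the pair that accepts at most one letter.
    All other letters sent to the pair share the other value, so both values are allowed at the
    pivot. *)
Lemma admissible_swap_at p g :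
  pivot g p -> admissible g -> admissible (swap_at p g).
Proof.
rewrite !admissibleE => /andP[gp /forallP piv] /forallP adm.
apply/forallP => x; apply/forallP => y; apply/implyP => xy.
have := adm x => /forallP/(_ y); rewrite xy /=.
(* A linear equation for the swapped value, so that the cases below are within reach of [lia]. *)
have swap_gp : (swap_letter (g p) + g p = i + i.+1)%N.
  by move: gp; rewrite /in_pair val_swap_letter; case: eqP; try case: eqP; lia.
have := piv x; have := piv y; move: gp; rewrite !ffunE /in_pair /precedes.
have [oi|oi] := boolP (odd i); have [xp|xp] := eqVneq x p;
  have [yp|yp] := eqVneq y p; rewrite ?xp ?yp in xy *.
all: by lia.
Qed.

Lemma pivotN_pair g : (forall x, ~~ pivot g x) -> forall x, ~~ in_pair (g x).
Proof.
move=> piv x0; apply/negP => gx0.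
case: (boolP (odd i)) => oi.
  case: (@arg_minnP _ x0 (fun x => in_pair (g x)) (fun x => val x) gx0) => p gp min.
  case/negP: (piv p); rewrite /pivot gp oi; apply/forallP => y; apply/implyP => yp.
  by apply/negP => /min /=; lia.
case: (@arg_maxnP _ x0 (fun x => in_pair (g x)) (fun x => val x) gx0) => p gp max.
case/negP: (piv p); rewrite /pivot gp (negPf oi).
apply/forallP => y; apply/implyP => yp.
by apply/negP => /max /=; lia.
Qed.

Variables (R : realType) (V : lmodType (complex R)).
Variable F : {ffun 'I_r -> 'I_n.+2} -> V.

(** Group the [g] by pivot. For a pivot [p], [swap_at p] is an involution that keeps the merged map
    and reverses the sign, so the group sums to zero. The maps without a pivot avoid the pair and
    are the [h] followed by [skip_letter]. *)
Lemma sum_merge_letter :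
  \sum_(g | admissible g) vsign R g *: F [ffun x => merge_letter (g x)] =
  \sum_(h | admissible h) vsign R h *: F [ffun x => skip_letter (h x)].
Proof.
pose G (g : {ffun 'I_r -> 'I_n.+2}) :=
  vsign R g *: F [ffun x => merge_letter (g x)].
pose pk (g : {ffun 'I_r -> 'I_n.+2}) := [pick p | pivot g p].
rewrite (partition_big pk predT) //= (bigD1 None) //=.
rewrite [X in _ + X]big1 ?addr0 => [|[p|//] _]; last first.
  set S := \sum_(g | _) _.
  suff SN : S = - S.
    apply/eqP; suff : 2%:R *: S == 0.
      by rewrite scaler_eq0 (Num.Theory.pnatr_eq0 (complex R)).
    by rewrite scaler_nat mulr2n {1}SN addNr.
  have pkP g : pk g == Some p -> pivot g p.
    by rewrite /pk; case: pickP => // x gx /eqP[<-].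
  have pk_swap g : pk (swap_at p g) = pk g.
    by rewrite /pk; apply: eq_pick; exact: pivot_swap_at.
  rewrite {1}/S (reindex_inj (inv_inj (swap_atK p))) -sumrN /=.
  apply: eq_big => g; rewrite pk_swap.
    case: eqP => [/eqP /pkP gp|_]; rewrite ?andbF // !andbT.
    apply/idP/idP => [|]; last exact: admissible_swap_at.
    by rewrite -{2}[g](swap_atK p); apply: admissible_swap_at; rewrite pivot_swap_at.
  case/andP => _ /pkP gp; rewrite -scaleNr; congr (_ *: F _); last first.
    apply/ffunP => x; rewrite !ffunE; case: ifP => // _.
    by rewrite merge_swap_letter.
  rewrite /vsign (bigD1 p) //= [in RHS](bigD1 p) //= ffunE eqxx.
  rewrite odd_swap_letter; last by case/andP: gp.
  rewrite -mulNr; congr (_ * _); first by case: odd; rewrite ?opprK.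
  by apply: eq_bigr => x /negPf xp; rewrite ffunE xp.
pose sk (h : {ffun 'I_r -> 'I_n}) := [ffun x => skip_letter (h x)].
have sk_inj : injective sk.
  move=> h k /ffunP e; apply/ffunP => x.
  by have := e x; rewrite !ffunE => /skip_letter_inj.
have admissible_sk h : admissible (sk h) = admissible h.
  rewrite !admissibleE; apply: eq_forallb => x; apply: eq_forallb => y.
  by rewrite !ffunE precedes_skip_letter.
rewrite (eq_bigl (mem (sk @: [set h | admissible h]))) => [|g /=].
  rewrite big_imset /=; last by move=> ? ? _ _; exact: sk_inj.
  rewrite big_set; apply: eq_bigr => h _.
  congr (_ *: F _).
    by apply: eq_bigr => x _; rewrite ffunE odd_skip_letter.
  apply/ffunP => x; rewrite !ffunE; apply/val_inj; rewrite /= val_merge_letter.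
  by have := skip_letterN_pair (h x); rewrite /in_pair negb_or => /andP[_ /negPf ->].
apply/andP/imsetP => [[adm /eqP pkg]|[h]]; last first.
  rewrite inE => adm ->; rewrite admissible_sk; split => //.
  rewrite /pk; case: pickP => // p /andP[]; rewrite ffunE.
  by rewrite (negPf (skip_letterN_pair _)).
have gN x : exists k, g x = skip_letter k.
  apply: skip_letter_ex; apply: pivotN_pair => p; apply/negbT.
  by move: pkg; rewrite /pk; case: pickP.
have [h gh] := fin_all_exists gN.
have gsk : g = sk (finfun h) by apply/ffunP => x; rewrite !ffunE.
by exists (finfun h); rewrite ?inE -?admissible_sk -gsk.
Qed.

End AdjacentPair.

Section VirtualEvaluation.
Variable R : realType.

Lemma ncsubst_ncvar m n (f : 'I_m -> 'I_n) w :
  ncsubst (fun j => ncvar R (f j)) (ncmonom R w) = ncmonom R (map f w).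
Proof. by rewrite ncsubst_ncmonom prod_ncvar. Qed.

Lemma ncsubst_Pvirtual m n (f : 'I_m -> 'I_n) u :
  ncsubst (fun j => ncvar R (f j)) (Pvirtual R u m) =
  \sum_(g : {ffun 'I_(max_letter (val u)) -> 'I_m} | admissible g)
    vsign R g *: ncmonom R (relabel [ffun x => f (g x)] (val u)).
Proof.
rewrite /Pvirtual linear_sum; apply: eq_bigr => g _.
rewrite linearZ /= vsignE ncsubst_ncvar; congr (_ *: ncmonom R _).
by rewrite /relabel -map_comp; apply: eq_map => x; rewrite /= ffunE.
Qed.

Lemma Pvirtual_merge_skip u n (i : 'I_n.+1) :
  ncsubst (merge_next R i) (Pvirtual R u n.+2) =
  ncsubst (skip_two R i) (Pvirtual R u n).
Proof.
rewrite (ncsubst_Pvirtual (merge_letter i)) (ncsubst_Pvirtual (skip_letter i)).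
exact: (sum_merge_letter i (fun g => ncmonom R (relabel g (val u)))).
Qed.

End VirtualEvaluation.

(** * Vanishing from the functional equation *)

Section FunctionalEquation.
Variables (R : realType) (Q : ncfamily R).
Hypothesis merge_skip : forall n (i : 'I_n.+1),
  ncsubst (merge_next R i) (Q n.+2) = ncsubst (skip_two R i) (Q n).

Lemma mem_map_skip_letter n (i : 'I_n.+1) v (x : 'I_n.+2) :
  x \in map (skip_letter i) v -> ~~ in_pair i x.
Proof. by case/mapP => y _ ->; exact: skip_letterN_pair. Qed.

Lemma map_merge_letter_id n (i : 'I_n.+1) (w : seq 'I_n.+2) :
  (forall x, x \in w -> x != i.+1 :> nat) -> map (merge_letter i) w = w.
Proof.
move=> wi; rewrite -[RHS]map_id; apply/eq_in_map => x /wi xi.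
by apply/val_inj; rewrite /= val_merge_letter (negPf xi).
Qed.

Lemma merge_letter_eqN_pair n (i : 'I_n.+1) (x y : 'I_n.+2) :
  merge_letter i x = y -> ~~ in_pair i y -> x = y.
Proof.
move=> <-; rewrite /in_pair val_merge_letter.
have [_|xi _] := eqVneq (nat_of_ord x) i.+1; first by rewrite eqxx.
by apply/val_inj; rewrite /= val_merge_letter (negPf xi).
Qed.

(** The word on the left avoids the pair, so it is alone in its fibre under merging, and [v] is
    alone in its fibre under skipping. Comparing coefficients of the functional equation gives the
    first relation. *)
Lemma mcoeff_skip n (i : 'I_n.+1) v :
  (Q n.+2)@_(FMonom (map (skip_letter i) v)) = (Q n)@_(FMonom v).
Proof.
set v' := map _ v.
rewrite -(mcoeff_ncsubst1 (s := merge_next R i)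
    (f := fun j => Some (merge_letter i j)) (v := v')) //.
- rewrite merge_skip.
  apply: (mcoeff_ncsubst1 (f := fun j => Some (skip_letter i j))) => //.
    by rewrite /v' -map_comp.
  move=> w; rewrite (map_comp Some) => /(inj_map (@Some_inj _)).
  by move=> /(inj_map (@skip_letter_inj _ i)) ->; rewrite eqxx.
- rewrite (map_comp Some) map_merge_letter_id // => x.
  by move=> /mem_map_skip_letter; rewrite /in_pair negb_or => /andP[].
move=> w; rewrite (map_comp Some) => /(inj_map (@Some_inj _)) wv' /eqP[].
rewrite -wv' map_merge_letter_id // => x xw.
have : merge_letter i x \in v' by rewrite -wv' map_f.
move=> /mem_map_skip_letter pN; have e := merge_letter_eqN_pair erefl pN.
by move: pN; rewrite -e /in_pair negb_or => /andP[].
Qed.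

(** The skipped side has no word containing [i], so the coefficients over the words that merge to
    [v] sum to zero. If all of them but the one at [v] vanish, so does that one. *)
Lemma mcoeff_merge n (i : 'I_n.+1) (v : seq 'I_n.+2) :
    has (fun x : 'I_n.+2 => x == i :> nat) v ->
    (forall w, map (merge_letter i) w = v -> w != v ->
       (Q n.+2)@_(FMonom w) = 0) ->
    map (merge_letter i) v = v ->
  (Q n.+2)@_(FMonom v) = 0.
Proof.
move=> /hasP[x xv /eqP xi] Qw vE.
rewrite -(mcoeff_ncsubst1 (s := merge_next R i)
    (f := fun j => Some (merge_letter i j)) (v := v)) //.
- rewrite merge_skip (mcoeff_ncsubst (f := fun j => Some (skip_letter i j))) //.
  rewrite big1 // => -[w]; rewrite (map_comp Some) /=.
  move=> /eqP /(inj_map (@Some_inj _)) wv.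
  by move: xv; rewrite -wv => /mem_map_skip_letter; rewrite /in_pair xi eqxx.
- by rewrite (map_comp Some) vE.
by move=> w; rewrite (map_comp Some) => /(inj_map (@Some_inj _)); exact: Qw.
Qed.

(* The letter x : 'I_n stands for a_(x+1), of odd index when x is even. *)
Definition even_letters n (v : seq 'I_n) := count (fun x : 'I_n => ~~ odd x) v.

(** Merging turns each odd value [i.+1] into the even value [i], and changes nothing else. *)
Lemma even_letters_merge n (i : 'I_n.+1) (w : seq 'I_n.+2) :
    ~~ odd i -> w != map (merge_letter i) w ->
  (even_letters w < even_letters (map (merge_letter i) w))%N.
Proof.
move=> oi wN; rewrite /even_letters count_map.
have -> : count (preim (merge_letter i) (fun x : 'I_n.+2 => ~~ odd x)) w =
    (count (fun x : 'I_n.+2 => ~~ odd x) w +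
     count (fun x : 'I_n.+2 => x == i.+1 :> nat) w)%N.
  elim: w {wN} => //= x w ->; rewrite val_merge_letter.
  by case: eqP => [->|_] /=; rewrite ?oi; lia.
rewrite -[X in (X < _)%N]addn0 ltn_add2l -has_count; apply: contraR wN => hN.
rewrite map_merge_letter_id // => x xw; apply: contraNneq hN => xi.
by apply/hasP; exists x; rewrite // xi.
Qed.

(** Induction on [n]: if an odd value [l] is missing, so is the even value [l.-1], and [mcoeff_skip]
    removes this pair. *)
Lemma mcoeff_all_odd :
    (forall n (v : seq 'I_n), all (fun x : 'I_n => odd x) v ->
       (forall l : 'I_n, odd l -> l \in v) -> (Q n)@_(FMonom v) = 0) ->
  forall n (v : seq 'I_n), all (fun x : 'I_n => odd x) v -> (Q n)@_(FMonom v) = 0.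
Proof.
move=> Qfull; elim/ltn_ind => n IHn v /allP vo.
have [full|] := boolP [forall l : 'I_n, odd l ==> (l \in v)].
  apply: Qfull; first exact/allP.
  by move=> l lo; have /forallP/(_ l) := full; rewrite lo.
rewrite negb_forall => /existsP[l]; rewrite negb_imply => /andP[lo lv].
(* An odd [l] below [n] forces [n] to be at least 2. *)
case: n l v => [|[|n]] l v in IHn vo lo lv *;
  [by case: l lo lv|by case: l lo lv => -[]|].
have l_lt := ltn_ord l.
have i_lt : (l.-1 < n.+1)%N by lia.
pose i := Ordinal i_lt.
have [v' v'E] : exists v', v = map (skip_letter i) v'.
  elim: v lv vo => [|x v IHv] lv vo; first by exists [::].
  have [||v' ->] := IHv.
  - by apply: contra lv => lv; rewrite inE lv orbT.
  - by move=> y yv; apply: vo; rewrite inE yv orbT.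
  have [|k ->] := @skip_letter_ex _ i x; last by exists (k :: v').
  have := vo x (mem_head _ _); move: lv; rewrite inE negb_or => /andP[lx _].
  by move: lx lo; rewrite -val_eqE /in_pair /=; lia.
rewrite v'E mcoeff_skip; apply: IHn => //; apply/allP => x xv'.
by rewrite -(odd_skip_letter i); apply: vo; rewrite v'E map_f.
Qed.

(** Induction on the number of even values, for all [n] at once because making room for a value
    raises [n] by 2. *)
Lemma mcoeff_vanish :
    (forall n (v : seq 'I_n), all (fun x : 'I_n => odd x) v ->
       (Q n)@_(FMonom v) = 0) ->
  forall n (v : seq 'I_n), (Q n)@_(FMonom v) = 0.
Proof.
move=> Qodd n v; have [k] := ubnP (even_letters v).
elim: k n v => // k IHk n v; rewrite ltnS => vk.
have [/Qodd //|/allPn[x xv xo]] := boolP (all (fun x : 'I_n => odd x) v).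
have x_lt : (x < n.+1)%N by have := ltn_ord x; lia.
have x1_lt : (x.+1 < n.+1)%N by have := ltn_ord x; lia.
pose i := Ordinal x_lt; pose i1 := Ordinal x1_lt.
(* Skipping at [i1] raises the values above [x] by 2. Then [x.+1] is free, and any other word that
   merges at [i] to the new word has fewer even values. *)
rewrite -(mcoeff_skip i1); apply: (@mcoeff_merge _ i).
- apply/hasP; exists (skip_letter i1 x); first exact: map_f.
  by rewrite val_skip_letter /= ltnSn.
- move=> w wE wN; apply: IHk; apply: leq_trans vk.
  have -> : even_letters v = even_letters (map (skip_letter i1) v).
    rewrite /even_letters count_map.
    by apply: eq_count => y /=; rewrite odd_skip_letter.
  by rewrite -wE; apply: even_letters_merge; rewrite ?wE.
apply: map_merge_letter_id => y /mem_map_skip_letter.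
by rewrite /in_pair /= negb_or => /andP[].
Qed.

End FunctionalEquation.

(** * Coefficients on words in the even variables *)

Lemma pack_map_mono (f : nat -> nat) (u : seq nat) :
  {in u &, {mono f : x y / (x <= y)%N}} -> pack (map f u) = pack u.
Proof.
move=> mono_f; rewrite /pack.
have inj_f : {in u &, injective f}.
  move=> x y xu yu fxy; apply/eqP.
  by rewrite eqn_leq -mono_f // -(mono_f y) // fxy leqnn.
have sub_u : {subset sort leq (undup u) <= u}.
  by move=> x; rewrite mem_sort mem_undup.
have -> : sort leq (undup (map f u)) = map f (sort leq (undup u)).
  apply: (sorted_eq leq_trans anti_leq).
  - exact: sort_sorted leq_total _.
  - apply: (@homo_sorted_in _ _ (mem u) f leq leq).
    + by move=> x y xu yu; rewrite mono_f.
    + by apply/allP => x /sub_u.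
    exact: sort_sorted leq_total _.
  apply: uniq_perm; rewrite ?sort_uniq ?undup_uniq //.
    rewrite map_inj_in_uniq ?sort_uniq ?undup_uniq //.
    by move=> x y /sub_u xu /sub_u yu; exact: inj_f.
  move=> x; rewrite mem_sort mem_undup.
  apply/mapP/mapP => -[y yu ->]; exists y => //.
    by rewrite mem_sort mem_undup.
  exact: sub_u.
rewrite -map_comp; apply/eq_in_map => x xu /=; congr _.+1.
elim: (sort leq (undup u)) sub_u => //= y s IHs sub_u.
have yu : y \in u by rewrite sub_u ?mem_head.
rewrite (inj_in_eq inj_f) // IHs // => z zs.
by apply: sub_u; rewrite inE zs orbT.
Qed.

(* Values of s that are not smaller than n are dropped. *)
Definition word_of n (s : seq nat) : seq 'I_n := pmap insub s.

Lemma val_word_of n s : all (fun k => (k < n)%N) s -> map val (word_of n s) = s.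
Proof.
move=> sn; rewrite /word_of pmap_filter; last exact: insubK.
apply/all_filterP.
by apply: sub_all sn => k kn /=; rewrite insubT.
Qed.

Lemma word_of_lift n s : all (fun k => (k < n)%N) s ->
  word_of n.+1 s = map (lift ord_max) (word_of n s).
Proof.
move=> sn; apply: (inj_map val_inj); rewrite val_word_of; last first.
  by apply: sub_all sn => k; exact: ltnW.
rewrite -map_comp -[LHS](val_word_of sn); apply: eq_map => x /=.
by rewrite /bump leqNgt ltn_ord.
Qed.

Lemma letters_inj n : injective (@letters n).
Proof. by apply: inj_map => i j [] /val_inj. Qed.

Lemma letters_relabel r N (g : 'I_r -> 'I_N) (f : nat -> nat) u :
    all (fun l => (0 < l <= r)%N) u ->
    (forall x : 'I_r, (x.+1 : nat) \in u -> f x.+1 = (g x).+1) ->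
  letters (relabel g u) = map f u.
Proof.
rewrite /letters /relabel; elim: u => //= l u IHu /andP[/andP[l0 lr] ur] gf.
have lr' : (l.-1 < r)%N by rewrite prednK.
rewrite insubT /= IHu // => [|x xu]; last by apply: gf; rewrite inE xu orbT.
by rewrite -gf /= prednK // mem_head.
Qed.

Lemma packed_le u : packed u -> all (fun l => (0 < l <= max_letter u)%N) u.
Proof. by move=> pu; apply/allP => l; rewrite mem_packed. Qed.

Lemma double_letters_lt n u : packed u -> ((max_letter u).*2 <= n)%N ->
  all (fun k => (k < n)%N) [seq l.*2.-1 | l <- u].
Proof.
move=> pu un; apply/allP => _ /mapP[l lu ->].
by have := allP (packed_le pu) _ lu; lia.
Qed.

Section OddWords.
Variables (R : realType) (n : nat) (v : seq 'I_n).
Hypothesis v_odd : all (fun x : 'I_n => odd x) v.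

(** The word u with v = 2u: an odd ordinal [x] stands for the even letter [x.+1]. *)
Definition half_letters := [seq l./2 | l <- letters v].

Lemma letters_double : letters v = map double half_letters.
Proof.
rewrite /half_letters -map_comp -[LHS]map_id; apply/eq_in_map => _ /mapP[x xv ->].
by rewrite /= uphalf_half (allP v_odd) //; have := allP v_odd _ xv; lia.
Qed.

Lemma pack_odd : packed half_letters -> pack (letters v) = half_letters.
Proof.
move=> pu; rewrite letters_double pack_map_mono ?pack_packed // => x y _ _.
exact: leq_double.
Qed.

Lemma packed_half_letters :
  (forall l : 'I_n, odd l -> l \in v) -> packed half_letters.
Proof.
move=> v_full; apply/andP; split.
  apply/negP => /mapP[_ /mapP[x xv ->]].
  by have := allP v_odd _ xv; lia.
apply/allP => _ /mapP[_ /mapP[x xv ->] ->]; apply/implyP => x1.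
have xo := allP v_odd _ xv; have x_lt := ltn_ord x.
(* The half letter before that of [x] comes from the odd value [x - 2]; by [x1], [x] is at least
   3. *)
have y_lt : (x - 2 < n)%N by lia.
apply/mapP; exists (x - 2).+1%N; last by lia.
apply/mapP; exists (Ordinal y_lt) => //; apply: v_full => /=; lia.
Qed.

(** Odd values are taken at most once, so a [g] producing [v] is strictly increasing. Packing then
    gives [half_letters = val u] and forces [g x = x.*2.+1], a map of sign 1. *)
Lemma mcoeff_Pvirtual_odd (u : packed_word) : packed half_letters ->
  (Pvirtual R u n)@_(FMonom v) = (half_letters == val u)%:R.
Proof.
move=> ph; rewrite /Pvirtual raddf_sum /=.
under eq_bigr => g _ do rewrite mcoeffZ mcoeff_ncmonom vsignE /=.
set r := max_letter (val u).
have u_le := packed_le (valP u); rewrite -/r in u_le.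
have mem_u (x : 'I_r) : x.+1 \in val u.
  by rewrite mem_packed ?ltn_ord //; exact: valP.
have gP (g : {ffun 'I_r -> 'I_n}) : admissible g -> relabel g (val u) = v ->
    half_letters = val u /\ forall x, g x = x.*2.+1 :> nat.
  rewrite admissibleE => /forallP adm gv.
  (* [g] on 1-based letters; the default 0 is not reached on letters of [u]. *)
  pose f l := oapp (fun x => (g x).+1) 0%N (insub l.-1).
  have fE (x : 'I_r) : f x.+1 = (g x).+1 by rewrite /f /= valK.
  have vf : letters v = map f (val u).
    by rewrite -gv; apply: letters_relabel u_le _ => x _; exact: fE.
  have g_odd x : odd (g x).
    have : f x.+1 \in letters v by rewrite vf map_f.
    by rewrite fE => /mapP[y yv [->]]; exact: (allP v_odd).
  have f_mono : {in val u &, {mono f : x y / (x <= y)%N}}.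
    apply: leq_mono_in => l k /(allP u_le)/andP[l0 lr] /(allP u_le)/andP[k0 kr] lk.
    have lr' : (l.-1 < r)%N by rewrite prednK.
    have kr' : (k.-1 < r)%N by rewrite prednK.
    have := adm (Ordinal lr') => /forallP/(_ (Ordinal kr')).
    have := fE (Ordinal lr'); have := fE (Ordinal kr'); rewrite /= !prednK //.
    move=> -> ->; rewrite /precedes g_odd andbF orbF ltnS => /implyP; apply.
    by lia.
  have hu : half_letters = val u.
    by rewrite -pack_odd // vf pack_map_mono // pack_packed //; exact: valP.
  split=> // x; have := letters_double; rewrite vf hu => /eq_in_map/(_ x.+1).
  by rewrite fE doubleS mem_u => /(_ isT) [].
have [hu|hu] := eqVneq half_letters (val u); last first.
  rewrite big1 // => g adm.
  case: eqP => [/(gP g adm)[/eqP]|_]; last by rewrite mulr0.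
  by rewrite (negPf hu).
(* The letter [x.+1] occurs in [u], so its double occurs in [letters v] and is at most [n]. *)
have g0_lt (x : 'I_r) : (x.*2.+1 < n)%N.
  have := mem_u x; rewrite -hu => /(map_f double); rewrite -letters_double.
  by move=> /mapP[y _]; rewrite doubleS => -[->].
pose g0 : {ffun 'I_r -> 'I_n} := [ffun x => Ordinal (g0_lt x)].
rewrite (bigD1 g0) /=; last first.
  rewrite admissibleE; apply/forallP => x; apply/forallP => y; apply/implyP => xy.
  by rewrite /precedes !ffunE /= !ltnS ltn_double xy.
have -> : relabel g0 (val u) = v.
  apply: letters_inj; rewrite letters_double hu.
  by apply: letters_relabel u_le _ => x _; rewrite ffunE.
rewrite eqxx mulr1 big1 ?addr0.
  by apply: big1 => x _; rewrite ffunE /= odd_double.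
move=> g /andP[adm gg0]; case: eqP => [/(gP g adm)[_ gE]|_]; last by rewrite mulr0.
by case/eqP: gg0; apply/ffunP => x; apply/val_inj; rewrite ffunE /= gE.
Qed.

End OddWords.

(** * Stable coefficients and bounded degree *)

Section EvenIndexedCoefficient.
Variables (R : realType) (P : ncfamily R).

(* The coefficient of a_(2 u_1) a_(2 u_2) ... in P_n. *)
Definition double_coef n (u : seq nat) : complex R :=
  (P n)@_(FMonom (word_of n [seq l.*2.-1 | l <- u])).

Hypothesis stableP : stable P.

Lemma mcoeff_stable n (w : seq 'I_n) :
  (P n.+1)@_(FMonom (map (lift ord_max) w)) = (P n)@_(FMonom w).
Proof.
rewrite -(stableP.2 n) (mcoeff_ncsubst1 (f := unlift ord_max)
  (w0 := map (lift ord_max) w)) //.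
- by rewrite -map_comp; apply: eq_map => x; rewrite /= liftK.
move=> w' w'E /eqP[]; elim: w' w w'E => [|x w' IHw] [|y w] //= [xy /IHw <-].
by case: unliftP xy => // j -> [->].
Qed.

Lemma double_coef_stable n u : packed u -> ((max_letter u).*2 <= n)%N ->
  double_coef n u = double_coef (max_letter u).*2 u.
Proof.
move=> pu un; rewrite -(subnK un); elim: (n - _)%N => // k IHk.
rewrite addSn -IHk /double_coef -[RHS]mcoeff_stable -word_of_lift //.
exact: double_letters_lt pu (leq_addl _ _).
Qed.

Lemma mcoeff_odd n (v : seq 'I_n) : all (fun x : 'I_n => odd x) v ->
    packed (half_letters v) ->
  (P n)@_(FMonom v) =
    double_coef (max_letter (half_letters v)).*2 (half_letters v).
Proof.
move=> v_odd ph.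
have v_word : word_of n [seq l.*2.-1 | l <- half_letters v] = v.
  have -> : [seq l.*2.-1 | l <- half_letters v] = map val v.
    rewrite (map_comp predn) -(letters_double v_odd) -map_comp.
    by apply: eq_map.
  apply: (inj_map val_inj); rewrite val_word_of //.
  by apply/allP => _ /mapP[x _ ->] /=.
rewrite -(@double_coef_stable n) //; first by rewrite /double_coef v_word.
have [->|r_gt0] := posnP (max_letter (half_letters v)); first by [].
have := max_letter_in r_gt0 => /(map_f double); rewrite -letters_double //.
by move=> /mapP[x _ ->].
Qed.

(** Beyond the degree bound [d] the coefficients vanish, and there are finitely many packed words of
    length at most [d], since their letters are at most [d]. *)
Lemma double_coef_finite :
  exists c : {malg (complex R)[packed_word]}, forall u,
    c@_u = double_coef (max_letter (val u)).*2 (val u).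
Proof.
have [d degP] := stableP.1.
(* All words of length at most [d] over 0, ..., [d]; here an ordinal is the letter itself, without
   the shift by one. *)
pose words := [seq map val (t : seq 'I_d.+1) |
  t <- flatten [seq map val (enum {: k.-tuple 'I_d.+1}) | k <- iota 0 d.+1]].
have mem_words s : packed s -> (size s <= d)%N -> s \in words.
  move=> ps sd.
  have sd1 : all (fun k => (k < d.+1)%N) s.
    apply/allP => l ls; rewrite ltnS; apply: leq_trans sd.
    exact: leq_trans (leq_max_letter ls) (max_letter_size ps).
  rewrite -(val_word_of sd1); apply: map_f.
  apply/flatten_mapP; exists (size (word_of d.+1 s)).
    by rewrite mem_iota /= add0n ltnS -(size_map val) val_word_of.
  by apply/mapP; exists (in_tuple (word_of d.+1 s)); rewrite ?mem_enum.
pose D : {fset packed_word} := [fset u in (pmap insub words : seq packed_word)]%fset.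
exists [malg u in D => double_coef (max_letter (val u)).*2 (val u)] => u.
rewrite mcoeffE; case: ifPn => // uD; apply/esym/mcoeff_outdom.
apply: contra uD => /degP; rewrite /fdeg /= -(size_map val) val_word_of.
  by rewrite size_map inE /= mem_pmap_sub; apply: mem_words; exact: valP.
exact: double_letters_lt (valP u) (leqnn _).
Qed.

End EvenIndexedCoefficient.

(** * The equivalence *)

Lemma evalA_Pcomb_merge_skip (R : realType) c n (i : 'I_n.+1) :
  ncsubst (merge_next R i) (evalA (Pcomb c) n.+2) =
  ncsubst (skip_two R i) (evalA (Pcomb c) n).
Proof.
rewrite /evalA PcombK !linear_sum; apply: eq_bigr => u _.
by rewrite !linearZ /= Pvirtual_merge_skip.
Qed.

Theorem theorem5p1 (R : realType) (P : ncfamily R) (stableP : stable P) :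
  (forall (n : nat) (i : 'I_n.+1),
     ncsubst (merge_next R i) (P n.+2) = ncsubst (skip_two R i) (P n))
  <->
  (exists2 F : ncfamily R, WQSym F & P = evalA F).
Proof.
split=> [merge_skip|[_ [c ->] ->] n i]; last exact: evalA_Pcomb_merge_skip.
have [c cE] := double_coef_finite stableP.
exists (Pcomb c); first by exists c.
apply: functional_extensionality_dep => n; apply/eqP; rewrite -subr_eq0; apply/eqP.
apply/malgP => -[v]; rewrite mcoeff0.
(* The functional equation is linear, so it passes to the difference, which then only has to vanish
   on words made of all the odd values. *)
pose Q n := P n - evalA (Pcomb c) n; rewrite -/(Q n).
have QE m (j : 'I_m.+1) :
    ncsubst (merge_next R j) (Q m.+2) = ncsubst (skip_two R j) (Q m).
  by rewrite /Q !linearB /= merge_skip evalA_Pcomb_merge_skip.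
apply: (mcoeff_vanish QE); apply: (mcoeff_all_odd QE) => {}n {}v v_odd v_full.
have ph := packed_half_letters v_odd v_full.
pose u : packed_word := exist _ (half_letters v) ph.
rewrite /Q mcoeffB (mcoeff_odd stableP v_odd ph) -(cE u).
apply/eqP; rewrite subr_eq0; apply/eqP; rewrite /evalA PcombK raddf_sum /=.
(* Only the summand at [u] survives; if [u] is outside the support of [c], both sides are 0. *)
under eq_bigr => w _ do
  rewrite mcoeffZ mcoeff_Pvirtual_odd // -[half_letters v]/(val u) val_eqE.
case: (msuppP c u) => uc.
  rewrite (big_fsetD1 u) //= eqxx mulr1 big1_fset ?addr0 // => w.
  by rewrite in_fsetD1 eq_sym => /andP[/negPf -> _] _; rewrite mulr0.
rewrite big1_fset // => w wc _.
by case: eqP => [uw|]; rewrite ?mulr0 // -uw (negPf uc) in wc *.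
Qed.
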